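(* Let $s\ge 1$, let $a_{ij},b_i\in\mathbb{R}$ ($i,j=1,\dots,s$) be Runge--Kutta coefficients with $c_i=\sum_{j=1}^s a_{ij}$, and suppose that $$b_ia_{ij}+b_ja_{ji}=b_ib_j\qquad\text{for all } i,j=1,\dots,s.$$ Let $M>0$ be an integer and let $(u^n,q^n)$, $n=0,1,2,\dots$, be produced with time step $\tau>0$ by the following prediction-correction scheme (Scheme 2.4). For each $n\ge0$, given $(u^n,q^n)$: 1. Prediction: set $k_i^{n,0}=u^n$ for $i=1,\dots,s$, and for $m=0,1,\dots,M-1$ compute, for $i=1,\dots,s$, $$u_i^{n,m}=u^n+\tau\sum_{j=1}^s a_{ij}k_j^{n,m},\qquad l_i^{n,m}=2u_i^{n,m}k_i^{n,m},\qquad q_i^{n,m}=q^n+\tau\sum_{j=1}^s a_{ij}l_j^{n,m},$$ $$k_i^{n,m+1}=\mathcal{S}\Big(u_i^{n,m}+\tfrac16q_i^{n,m}+\tfrac13(u_i^{n,m})^2\Big);$$ then set $u_i^{n,*}=u_i^{n,M}:=u^n+\tau\sum_{j=1}^s a_{ij}k_j^{n,M}$. 2. Correction: the stages $u_i^n,q_i^n,k_i^n,l_i^n$ satisfy, for $i=1,\dots,s$, $$k_i^n=\mathcal{S}\Big(u_i^n+\tfrac16q_i^n+\tfrac13u_i^{n,*}u_i^n\Big),\qquad u_i^n=u^n+\tau\sum_{j=1}^s a_{ij}k_j^n,$$ $$q_i^n=q^n+\tau\sum_{j=1}^s a_{ij}l_j^n,\qquad l_i^n=2u_i^{n,*}k_i^n,$$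 and $$u^{n+1}=u^n+\tau\sum_{i=1}^s b_ik_i^n,\qquad q^{n+1}=q^n+\tau\sum_{i=1}^s b_il_i^n.$$ Then the scheme preserves the semi-discrete energy: $$E^{n+1}=E^n,\qquad E^n:=\int_\Omega\Big(\tfrac12(u^n)^2+\tfrac16u^nq^n\Big)d\mathbf{x},\qquad n=0,1,2,\dots$$
   Context: Setting: the regularized long-wave equation $\partial_tu+\alpha\partial_xu+\beta\partial_yu+\alpha u\partial_xu+\beta u\partial_yu-\mu\partial_{xxt}u-\theta\partial_{yyt}u=0$ on $\Omega=[a,b]\times[c,d]$ with periodic boundary conditions, where $\alpha,\beta\in\mathbb{R}$, $\mu>0$, $\theta>0$ are constants. All functions of $\mathbf{x}=(x,y)$ are real-valued, periodic on $\Omega$ and smooth; the scheme is discrete in time only. $\mathcal{S}=-(1-\mu\partial_{xx}-\theta\partial_{yy})^{-1}(\alpha\partial_x+\beta\partial_y)$, acting on periodic functions. With the auxiliary variable $q=u^2$, the equation is reformulated as $\partial_tu=\mathcal{S}(u+\frac16q+\frac13u^2)$, $\partial_tq=2u\,\partial_tu$, of which the scheme is a linearized time discretization. Time grid: $t_n=n\tau$, $t_{ni}=t_n+c_i\tau$, with $c_1,\dots,c_s$ distinct real numbers; $u^n,q^n$ and $u_i^n,q_i^n$ approximate $u,q$ at $t_n$ and $t_{ni}$. *)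

(* Defs.v *)
From Stdlib Require Import Reals.
From Coquelicot Require Import Coquelicot.
Open Scope R_scope.

Definition field := R -> R -> R.

Definition smooth (f : field) : Prop :=
  forall (n : nat) (x y : R), ex_diff_n f n x y.

(* A periodic function on [a,b] x [c,d] is represented by its periodic
   extension to the whole plane. *)
Definition smooth_periodic (a b c d : R) (f : field) : Prop :=
  smooth f /\
  (forall x y : R, f (x + (b - a)) y = f x y) /\
  (forall x y : R, f x (y + (d - c)) = f x y).

(* Graph of S = - (1 - mu d_xx - theta d_yy)^{-1} (alpha d_x + beta d_y).
   For mu, theta > 0 the operator 1 - mu d_xx - theta d_yy is a bijection of the
   space of smooth periodic functions, so k = S f means that k is the element of
   this space with (1 - mu d_xx - theta d_yy) k = - (alpha d_x + beta d_y) f. *)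
Definition S_graph (a b c d alpha beta mu theta : R) (f k : field) : Prop :=
  smooth_periodic a b c d f /\
  smooth_periodic a b c d k /\
  forall x y : R,
    k x y - mu * partial_derive 2 0 k x y - theta * partial_derive 0 2 k x y =
    - (alpha * partial_derive 1 0 f x y + beta * partial_derive 0 1 f x y).

Definition rk_stage (s : nat) (A : nat -> nat -> R) (tau : R)
    (v : field) (k : nat -> field) (i : nat) : field :=
  fun x y => v x y + tau * sum_n_m (fun j => A i j * k j x y) 1 s.

Definition rk_update (s : nat) (w : nat -> R) (tau : R)
    (v : field) (k : nat -> field) : field :=
  fun x y => v x y + tau * sum_n_m (fun i => w i * k i x y) 1 s.

(* [kp m i] is k_i^{n,m}; [Sop f k] reads k = S f. *)
Definition prediction (Sop : field -> field -> Prop)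
    (s : nat) (A : nat -> nat -> R) (tau : R) (M : nat)
    (un qn : field) (kp : nat -> nat -> field) : Prop :=
  (forall i : nat, (1 <= i <= s)%nat -> forall x y : R, kp 0%nat i x y = un x y) /\
  (forall m i : nat, (m < M)%nat -> (1 <= i <= s)%nat ->
     let um := rk_stage s A tau un (kp m) in
     let lm := fun (j : nat) (x y : R) => 2 * um j x y * kp m j x y in
     let qm := rk_stage s A tau qn lm in
     Sop (fun x y => um i x y + / 6 * qm i x y + / 3 * (um i x y) ^ 2)
         (kp (S m) i)).

Definition correction (Sop : field -> field -> Prop)
    (s : nat) (A : nat -> nat -> R) (tau : R)
    (un qn : field) (us ui qi ki li : nat -> field) : Prop :=
  forall i : nat, (1 <= i <= s)%nat ->
    Sop (fun x y => ui i x y + / 6 * qi i x y + / 3 * (us i x y * ui i x y)) (ki i) /\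
    (forall x y : R, ui i x y = rk_stage s A tau un ki i x y) /\
    (forall x y : R, qi i x y = rk_stage s A tau qn li i x y) /\
    (forall x y : R, li i x y = 2 * us i x y * ki i x y).

Definition pc_step (Sop : field -> field -> Prop)
    (s : nat) (A : nat -> nat -> R) (w : nat -> R) (tau : R) (M : nat)
    (un qn un1 qn1 : field) : Prop :=
  exists (kp : nat -> nat -> field) (ui qi ki li : nat -> field),
    prediction Sop s A tau M un qn kp /\
    correction Sop s A tau un qn (rk_stage s A tau un (kp M)) ui qi ki li /\
    (forall x y : R, un1 x y = rk_update s w tau un ki x y) /\
    (forall x y : R, qn1 x y = rk_update s w tau qn li x y).

Definition energy (a b c d : R) (u q : field) : R :=
  RInt (fun x => RInt (fun y => / 2 * (u x y) ^ 2 + / 6 * (u x y * q x y)) c d) a b.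

(* Main.v *)
Require Import Defs.
From Stdlib Require Import Reals Lra Lia Psatz.
From Coquelicot Require Import Coquelicot.
Open Scope R_scope.

(** The scheme is a Runge-Kutta method for a system in which [u' = S f] and
    [q' = 2 u* u'], where [f = u + q/6 + u* u/3] and the predicted stage [u*]
    is a frozen coefficient.  The energy density [u^2/2 + u q/6] is quadratic,
    and its derivative along that system is
      [u k + (2 u u* k + q k)/6 = k f],   with [k = S f].

    Time direction.  The condition [b_i a_ij + b_j a_ji = b_i b_j] makes a
    Runge-Kutta step obey the discrete Leibniz rule for products
    ([symplectic_product]); hence, pointwise in space,
    the energy density changes by exactly [tau * sum_i b_i k_i f_i] in one step,
    whatever the predicted stages are.

    Space direction.  It remains to see that [k = S f] makes the integral of
    [k f] vanish ([S_graph_orthogonal]), i.e. that the graph of [S] is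
    skew.  Writing [S] as minus the product of two commuting operators would
    call for solving [(1 - mu d_xx - theta d_yy) h = f].  This is avoided with
    correlations: put
      [C g (s,t) = integral of g(x+s,y+t) f(x,y)].
    Translations commute with derivatives, so the equation linking [k] and [f]
    becomes [(1 - mu d_ss - theta d_tt) (C k) = - (alpha d_s + beta d_t) (C f)].
    By translation invariance of the integral over a period, [C f] is
    even under [(s,t) -> (-s,-t)], so the right-hand side is odd, and the even
    part of [C k] is a periodic solution of the homogeneous Helmholtz equation.
    By the maximum principle it is zero ([helmholtz_unique]); its
    value at the origin is a multiple of the integral of [k f].

    Derivatives are moved under the double integral by a quadratic estimate of
    the Taylor remainder, uniform because smooth periodic functions and their
    derivatives are bounded ([is_derive_RInt2_param]). *)

(** * Smooth doubly periodic functions *)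

Definition continuous2 (f : field) : Prop :=
  forall x y : R, continuity_2d_pt f x y.

Definition biperiodic (a b c d : R) (f : field) : Prop :=
  (forall x y : R, f (x + (b - a)) y = f x y) /\
  (forall x y : R, f x (y + (d - c)) = f x y).

Definition dx (f : field) : field := fun x y => Derive (fun z => f z y) x.
Definition dy (f : field) : field := fun x y => Derive (fun z => f x z) y.

Lemma smooth_continuous2 (f : field) : smooth f -> continuous2 f.
Proof. intros Hf x y. exact (proj1 (Hf 0%nat x y)). Qed.

Lemma smooth_dx (f : field) : smooth f -> smooth (dx f).
Proof. intros Hf n x y. exact (proj1 (proj2 (proj2 (proj2 (Hf (S n) x y))))). Qed.

Lemma smooth_dy (f : field) : smooth f -> smooth (dy f).
Proof. intros Hf n x y. exact (proj2 (proj2 (proj2 (proj2 (Hf (S n) x y))))). Qed.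

Lemma smooth_is_derive_x (f : field) (x y : R) :
  smooth f -> is_derive (fun z => f z y) x (dx f x y).
Proof.
  intros Hf. apply Derive_correct. exact (proj1 (proj2 (Hf 1%nat x y))).
Qed.

Lemma smooth_is_derive_y (f : field) (x y : R) :
  smooth f -> is_derive (fun z => f x z) y (dy f x y).
Proof.
  intros Hf. apply Derive_correct. exact (proj1 (proj2 (proj2 (Hf 1%nat x y)))).
Qed.

Lemma is_derive_shift (p : R -> R) (l r s : R) :
  is_derive p (r + s) l -> is_derive (fun z => p (z + s)) r l.
Proof.
  intros Hp.
  replace l with (scal 1 l) by (unfold scal; simpl; unfold mult; simpl; ring).
  apply (is_derive_comp p (fun z => z + s)); [exact Hp|].
  auto_derive; [exact I | ring].
Qed.

Lemma is_derive_reflect (p : R -> R) (l x : R) :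
  is_derive p (- x) l -> is_derive (fun z => p (- z)) x (- l).
Proof.
  intros Hp.
  replace (- l) with (scal (-1) l) by (unfold scal; simpl; unfold mult; simpl; ring).
  apply (is_derive_comp p (fun z => - z)); [exact Hp|].
  auto_derive; [exact I | ring].
Qed.

Lemma biperiodic_dx (a b c d : R) (f : field) :
  smooth f -> biperiodic a b c d f -> biperiodic a b c d (dx f).
Proof.
  intros Hf [Hx Hy]. split; intros x y.
  - symmetry. apply is_derive_unique.
    apply is_derive_ext with (fun z => f (z + (b - a)) y).
    { intros z. apply Hx. }
    apply is_derive_shift with (p := fun z => f z y).
    apply smooth_is_derive_x, Hf.
  - apply Derive_ext. intros z. apply Hy.
Qed.

Lemma biperiodic_dy (a b c d : R) (f : field) :
  smooth f -> biperiodic a b c d f -> biperiodic a b c d (dy f).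
Proof.
  intros Hf [Hx Hy]. split; intros x y.
  - apply Derive_ext. intros z. apply Hx.
  - symmetry. apply is_derive_unique.
    apply is_derive_ext with (fun z => f x (z + (d - c))).
    { intros z. apply Hy. }
    apply is_derive_shift with (p := fun z => f x z).
    apply smooth_is_derive_y, Hf.
Qed.

Lemma smooth_periodic_dx (a b c d : R) (f : field) :
  smooth_periodic a b c d f -> smooth_periodic a b c d (dx f).
Proof.
  intros [Hf Hp]. split; [apply smooth_dx, Hf | apply biperiodic_dx; assumption].
Qed.

Lemma smooth_periodic_dy (a b c d : R) (f : field) :
  smooth_periodic a b c d f -> smooth_periodic a b c d (dy f).
Proof.
  intros [Hf Hp]. split; [apply smooth_dy, Hf | apply biperiodic_dy; assumption].
Qed.

(** * Continuity of functions of two variables *)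

Lemma continuous2_slice_x (f : field) (x y : R) :
  continuous2 f -> continuous (fun z => f z y) x.
Proof.
  intros Hf. apply continuity_pt_filterlim.
  intros eps Heps. destruct (Hf x y (mkposreal eps Heps)) as [de Hde].
  exists de. split; [apply cond_pos|]. intros z [_ Hz]. simpl in *.
  unfold R_dist in *. apply Hde; [exact Hz|].
  rewrite Rminus_eq_0, Rabs_R0. apply cond_pos.
Qed.

Lemma continuous2_slice_y (f : field) (x y : R) :
  continuous2 f -> continuous (fun z => f x z) y.
Proof.
  intros Hf. apply continuity_pt_filterlim.
  intros eps Heps. destruct (Hf x y (mkposreal eps Heps)) as [de Hde].
  exists de. split; [apply cond_pos|]. intros z [_ Hz]. simpl in *.
  unfold R_dist in *. apply Hde; [|exact Hz].
  rewrite Rminus_eq_0, Rabs_R0. apply cond_pos.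
Qed.

Lemma continuous2_translate (f : field) (s t : R) :
  continuous2 f -> continuous2 (fun x y => f (x + s) (y + t)).
Proof.
  intros Hf x y eps. destruct (Hf (x + s) (y + t) eps) as [de Hde].
  exists de. intros u v Hu Hv. apply Hde.
  - replace (u + s - (x + s)) with (u - x) by ring. exact Hu.
  - replace (v + t - (y + t)) with (v - y) by ring. exact Hv.
Qed.

Lemma continuous2_scal (l : R) (f : field) :
  continuous2 f -> continuous2 (fun x y => l * f x y).
Proof.
  intros Hf x y. apply continuity_2d_pt_mult; [apply continuity_2d_pt_const | apply Hf].
Qed.

Lemma continuous2_plus (f g : field) :
  continuous2 f -> continuous2 g -> continuous2 (fun x y => f x y + g x y).
Proof. intros Hf Hg x y. apply continuity_2d_pt_plus; auto. Qed.

Lemma continuous2_mult (f g : field) :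
  continuous2 f -> continuous2 g -> continuous2 (fun x y => f x y * g x y).
Proof. intros Hf Hg x y. apply continuity_2d_pt_mult; auto. Qed.

Lemma continuous2_abs (f : field) :
  continuous2 f -> continuous2 (fun x y => Rabs (f x y)).
Proof.
  intros Hf x y. apply continuity_1d_2d_pt_comp; [apply Rcontinuity_abs | apply Hf].
Qed.

Lemma biperiodic_translate (a b c d : R) (f : field) (s t : R) :
  biperiodic a b c d f -> biperiodic a b c d (fun x y => f (x + s) (y + t)).
Proof.
  intros [Hx Hy]. split; intros x y.
  - replace (x + (b - a) + s) with (x + s + (b - a)) by ring. apply Hx.
  - replace (y + (d - c) + t) with (y + t + (d - c)) by ring. apply Hy.
Qed.

Lemma biperiodic_mult (a b c d : R) (f g : field) :
  biperiodic a b c d f -> biperiodic a b c d g ->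
  biperiodic a b c d (fun x y => f x y * g x y).
Proof.
  intros [Hfx Hfy] [Hgx Hgy]. split; intros x y.
  - now rewrite Hfx, Hgx.
  - now rewrite Hfy, Hgy.
Qed.

(** * Extrema of doubly periodic functions *)

Lemma periodic_IZR (p : R -> R) (T : R) :
  (forall x, p (x + T) = p x) -> forall (k : Z) (x : R), p (x + IZR k * T) = p x.
Proof.
  intros Hp k. induction k as [|k IH|k IH] using Z.peano_ind; intros x.
  - f_equal; ring.
  - rewrite succ_IZR, <- (IH x), <- (Hp (x + IZR k * T)). f_equal; ring.
  - unfold Z.pred. rewrite plus_IZR, <- (IH x), <- Hp. f_equal; ring.
Qed.

Lemma period_representative (a b x : R) :
  a < b -> exists k : Z, a <= x + IZR k * (b - a) <= b.
Proof.
  intros Hab.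
  destruct (archimed ((x - a) / (b - a))) as [H1 H2].
  set (N := up ((x - a) / (b - a))) in *.
  exists (1 - N)%Z. rewrite minus_IZR.
  assert (E : (x - a) / (b - a) * (b - a) = x - a) by (field; lra).
  set (r := (x - a) / (b - a)) in *.
  assert (x = a + r * (b - a)) by lra.
  nra.
Qed.

(** Maximize along rows first: the row maxima depend continuously on the row, so
    two applications of the one-variable extreme value theorem suffice. *)
Lemma continuous2_box_max (a b c d : R) (f : field) :
  a <= b -> c <= d -> continuous2 f ->
  exists x0 y0 : R, forall x y : R,
    a <= x <= b -> c <= y <= d -> f x y <= f x0 y0.
Proof.
  intros Hab Hcd Hf.
  assert (Hrow : forall y, exists x0, (forall x, a <= x <= b -> f x y <= f x0 y) /\ a <= x0 <= b).
  { intros y. apply (continuity_ab_maj (fun x => f x y)); [exact Hab|].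
    intros x _. apply continuity_pt_filterlim. apply continuous2_slice_x, Hf. }
  (* The row maximum is taken as a supremum, which makes it a function of [y]
     without a choice of maximizers. *)
  set (m := fun y => real (Lub_Rbar (fun v => exists x, a <= x <= b /\ v = f x y))).
  assert (Hm : forall y x0, (forall x, a <= x <= b -> f x y <= f x0 y) -> a <= x0 <= b ->
                 m y = f x0 y).
  { intros y x0 H1 H2. unfold m.
    rewrite (is_lub_Rbar_unique _ (Finite (f x0 y))); [reflexivity|].
    split.
    - intros v [x [Hx ->]]. apply H1, Hx.
    - intros l Hl. apply Hl. exists x0. auto. }
  (* [f] is uniformly continuous, so [m] is continuous: compare [m y] and [m z]
     at the maximizers of both rows. *)
  destruct (continuity_ab_maj m c d Hcd) as [y0 [Hy0 _]].
  - intros y Hy eps Heps.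
    destruct (uniform_continuity_2d f a b (y - 1) (y + 1)
                (fun x z _ _ => Hf x z) (mkposreal eps Heps)) as [de Hde].
    exists (Rmin de 1). split.
    { apply Rmin_pos; [apply cond_pos | lra]. }
    intros z [_ Hz]. simpl in *. unfold R_dist in *.
    assert (Hz1 : Rabs (z - y) < de) by (eapply Rlt_le_trans; [exact Hz | apply Rmin_l]).
    assert (Hz2 : Rabs (z - y) < 1) by (eapply Rlt_le_trans; [exact Hz | apply Rmin_r]).
    apply Rabs_def2 in Hz2.
    destruct (Hrow y) as [x1 [A1 B1]], (Hrow z) as [x2 [A2 B2]].
    rewrite (Hm y x1), (Hm z x2) by assumption.
    assert (K : forall x, a <= x <= b -> Rabs (f x z - f x y) < eps).
    { intros x Hx. apply (Hde x y x z); auto; try lra.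
      rewrite Rminus_eq_0, Rabs_R0. apply cond_pos. }
    pose proof (Rabs_def2 _ _ (K x1 B1)). pose proof (Rabs_def2 _ _ (K x2 B2)).
    pose proof (A1 x2 B2). pose proof (A2 x1 B1).
    apply Rabs_def1; lra.
  - destruct (Hrow y0) as [x0 [A0 B0]]. exists x0, y0. intros x y Hx Hy.
    destruct (Hrow y) as [x1 [A1 B1]].
    rewrite <- (Hm y0 x0) by assumption.
    apply Rle_trans with (m y); [|apply Hy0, Hy].
    rewrite (Hm y x1) by assumption. apply A1, Hx.
Qed.

Lemma biperiodic_max (a b c d : R) (f : field) :
  a < b -> c < d -> continuous2 f -> biperiodic a b c d f ->
  exists x0 y0 : R, forall x y : R, f x y <= f x0 y0.
Proof.
  intros Hab Hcd Hf [Hx Hy].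
  destruct (continuous2_box_max a b c d f) as [x0 [y0 H0]]; [lra|lra|exact Hf|].
  exists x0, y0. intros x y.
  destruct (period_representative a b x Hab) as [k Hk].
  destruct (period_representative c d y Hcd) as [l Hl].
  rewrite <- (periodic_IZR (fun z => f z y) (b - a) (fun z => Hx z y) k x).
  rewrite <- (periodic_IZR (fun z => f (x + IZR k * (b - a)) z) (d - c) (fun z => Hy _ z) l y).
  apply H0; assumption.
Qed.

Lemma biperiodic_bounded (a b c d : R) (f : field) :
  a < b -> c < d -> continuous2 f -> biperiodic a b c d f ->
  exists C : R, forall x y : R, Rabs (f x y) <= C.
Proof.
  intros Hab Hcd Hf [Hx Hy].
  destruct (biperiodic_max a b c d (fun x y => Rabs (f x y))) as [x0 [y0 H0]]; auto.
  - apply continuous2_abs, Hf.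
  - split; intros x y; f_equal; auto.
  - exists (Rabs (f x0 y0)). exact H0.
Qed.

(** * Maximum principle for the Helmholtz operator *)

(** If [l] were positive, [p1], which vanishes at the maximum, would be positive
    just to the right of it, and [p] would increase there. *)
Lemma second_derivative_at_max (p p1 : R -> R) (x0 l : R) :
  (forall x, is_derive p x (p1 x)) -> is_derive p1 x0 l ->
  (forall x, p x <= p x0) -> l <= 0.
Proof.
  intros Hp Hp1 Hmax.
  assert (H0 : p1 x0 = 0).
  { pose (pr := exist _ (p1 x0) (proj1 (is_derive_Reals _ _ _) (Hp x0)) : derivable_pt p x0).
    change (derive_pt p x0 pr = 0).
    apply (deriv_maximum p (x0 - 1) (x0 + 1)); try lra. intros; apply Hmax. }
  apply Rnot_lt_le. intros Hl.
  apply is_derive_Reals in Hp1.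
  destruct (Hp1 l Hl) as [de Hde]. destruct de as [de Hpos]. simpl in Hde.
  assert (K : forall h, 0 < h < de -> 0 < p1 (x0 + h)).
  { intros h Hh. assert (Hq := Hde h).
    rewrite H0, Rminus_0_r in Hq.
    assert (Q : Rabs (p1 (x0 + h) / h - l) < l) by (apply Hq; [lra | rewrite Rabs_pos_eq; lra]).
    apply Rabs_def2 in Q. destruct Q as [_ Q].
    assert (0 < p1 (x0 + h) / h) by lra.
    replace (p1 (x0 + h)) with (p1 (x0 + h) / h * h) by (field; lra).
    apply Rmult_lt_0_compat; lra. }
  destruct (MVT_cor2 p p1 x0 (x0 + de / 2)) as [z [Hz1 Hz2]]; [lra| |].
  { intros z _. apply is_derive_Reals, Hp. }
  assert (0 < p1 z).
  { replace z with (x0 + (z - x0)) by ring. apply K. lra. }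
  pose proof (Hmax (x0 + de / 2)).
  assert (0 < p1 z * (x0 + de / 2 - x0)) by (apply Rmult_lt_0_compat; lra).
  lra.
Qed.

(** At a global maximum both second derivatives are nonpositive, so the
    inequality bounds the maximum itself by zero. *)
Lemma maximum_principle (a b c d mu theta : R) (H Hx Hy Hxx Hyy : field) :
  a < b -> c < d -> 0 < mu -> 0 < theta ->
  continuous2 H -> biperiodic a b c d H ->
  (forall x y, is_derive (fun z => H z y) x (Hx x y)) ->
  (forall x y, is_derive (fun z => Hx z y) x (Hxx x y)) ->
  (forall x y, is_derive (fun z => H x z) y (Hy x y)) ->
  (forall x y, is_derive (fun z => Hy x z) y (Hyy x y)) ->
  (forall x y, H x y - mu * Hxx x y - theta * Hyy x y <= 0) ->
  forall x y, H x y <= 0.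
Proof.
  intros Hab Hcd Hmu Htheta Hc Hp D1 D2 D3 D4 Hsub x y.
  destruct (biperiodic_max a b c d H) as [x0 [y0 Hmax]]; auto.
  assert (Hxx x0 y0 <= 0).
  { apply (second_derivative_at_max (fun z => H z y0) (fun z => Hx z y0) x0); auto. }
  assert (Hyy x0 y0 <= 0).
  { apply (second_derivative_at_max (fun z => H x0 z) (fun z => Hy x0 z) y0); auto. }
  pose proof (Hsub x0 y0). pose proof (Hmax x y). nra.
Qed.

(** The maximum principle applies to [H] and to [- H]. *)
Lemma helmholtz_unique (a b c d mu theta : R) (H Hx Hy Hxx Hyy : field) :
  a < b -> c < d -> 0 < mu -> 0 < theta ->
  continuous2 H -> biperiodic a b c d H ->
  (forall x y, is_derive (fun z => H z y) x (Hx x y)) ->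
  (forall x y, is_derive (fun z => Hx z y) x (Hxx x y)) ->
  (forall x y, is_derive (fun z => H x z) y (Hy x y)) ->
  (forall x y, is_derive (fun z => Hy x z) y (Hyy x y)) ->
  (forall x y, H x y - mu * Hxx x y - theta * Hyy x y = 0) ->
  forall x y, H x y = 0.
Proof.
  intros Hab Hcd Hmu Htheta Hc Hp D1 D2 D3 D4 HL x y.
  apply Rle_antisym.
  - apply (maximum_principle a b c d mu theta H Hx Hy Hxx Hyy); auto.
    intros x' y'. right. apply HL.
  - assert (- H x y <= 0); [|lra].
    apply (maximum_principle a b c d mu theta (fun x y => - H x y) (fun x y => - Hx x y)
      (fun x y => - Hy x y) (fun x y => - Hxx x y) (fun x y => - Hyy x y)); auto.
    + intros x' y'. apply continuity_2d_pt_opp, Hc.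
    + destruct Hp as [Px Py]. split; intros x' y'; f_equal; auto.
    + intros x' y'. apply (is_derive_opp (V := R_NormedModule) (fun z => H z y')), D1.
    + intros x' y'. apply (is_derive_opp (V := R_NormedModule) (fun z => Hx z y')), D2.
    + intros x' y'. apply (is_derive_opp (V := R_NormedModule) (fun z => H x' z)), D3.
    + intros x' y'. apply (is_derive_opp (V := R_NormedModule) (fun z => Hy x' z)), D4.
    + intros x' y'. pose proof (HL x' y'). lra.
Qed.

(** * Double integrals of continuous functions *)

Definition RInt2 (a b c d : R) (g : field) : R :=
  RInt (fun x => RInt (fun y => g x y) c d) a b.

Lemma continuous2_ex_RInt_y (g : field) (x c d : R) :
  continuous2 g -> ex_RInt (fun y => g x y) c d.
Proof.
  intros Hg. apply (ex_RInt_continuous (V := R_CompleteNormedModule)).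
  intros z _. apply continuous2_slice_y, Hg.
Qed.

Lemma continuous_RInt_y (g : field) (c d x : R) :
  c < d -> continuous2 g -> continuous (fun x => RInt (fun y => g x y) c d) x.
Proof.
  intros Hcd Hg. apply continuity_pt_filterlim. intros eps Heps.
  set (e := eps / (2 * (d - c))).
  assert (He : 0 < e) by (apply Rdiv_lt_0_compat; lra).
  destruct (uniform_continuity_2d g (x - 1) (x + 1) c d
              (fun x z _ _ => Hg x z) (mkposreal e He)) as [de Hde].
  exists (Rmin de 1). split.
  { apply Rmin_pos; [apply cond_pos | lra]. }
  intros z [_ Hz]. simpl in *. unfold R_dist in *.
  assert (Hz1 : Rabs (z - x) < de) by (eapply Rlt_le_trans; [exact Hz | apply Rmin_l]).
  assert (Hz2 : Rabs (z - x) < 1) by (eapply Rlt_le_trans; [exact Hz | apply Rmin_r]).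
  apply Rabs_def2 in Hz2.
  rewrite <- (RInt_minus (V := R_CompleteNormedModule))
    by (apply continuous2_ex_RInt_y, Hg).
  apply Rle_lt_trans with ((d - c) * e).
  - apply abs_RInt_le_const; [lra| |].
    + apply (ex_RInt_minus (V := R_NormedModule)); apply continuous2_ex_RInt_y, Hg.
    + intros t Ht. unfold minus, plus, opp; simpl. left.
      apply (Hde x t z t); auto; try lra.
      rewrite Rminus_eq_0, Rabs_R0. apply cond_pos.
  - unfold e. replace ((d - c) * (eps / (2 * (d - c)))) with (eps / 2) by (field; lra). lra.
Qed.

Lemma ex_RInt_RInt_y (g : field) (a b c d : R) :
  c < d -> continuous2 g -> ex_RInt (fun x => RInt (fun y => g x y) c d) a b.
Proof.
  intros Hcd Hg. apply (ex_RInt_continuous (V := R_CompleteNormedModule)).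
  intros z _. apply continuous_RInt_y; assumption.
Qed.

Lemma RInt2_ext (a b c d : R) (f g : field) :
  (forall x y, f x y = g x y) -> RInt2 a b c d f = RInt2 a b c d g.
Proof.
  intros E. apply RInt_ext. intros x _. apply RInt_ext. intros y _. apply E.
Qed.

Lemma RInt2_plus (a b c d : R) (f g : field) :
  c < d -> continuous2 f -> continuous2 g ->
  RInt2 a b c d (fun x y => f x y + g x y) = RInt2 a b c d f + RInt2 a b c d g.
Proof.
  intros Hcd Hf Hg. unfold RInt2.
  rewrite <- (RInt_plus (V := R_CompleteNormedModule))
    by (apply ex_RInt_RInt_y; assumption).
  apply RInt_ext. intros x _.
  apply (RInt_plus (V := R_CompleteNormedModule)); apply continuous2_ex_RInt_y; assumption.
Qed.

Lemma RInt2_scal (a b c d l : R) (f : field) :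
  c < d -> continuous2 f ->
  RInt2 a b c d (fun x y => l * f x y) = l * RInt2 a b c d f.
Proof.
  intros Hcd Hf. unfold RInt2.
  rewrite <- (RInt_scal (V := R_CompleteNormedModule) _ a b l)
    by (apply ex_RInt_RInt_y; assumption).
  apply RInt_ext. intros x _.
  apply (RInt_scal (V := R_CompleteNormedModule)); apply continuous2_ex_RInt_y; assumption.
Qed.

Lemma abs_RInt2_le (a b c d C : R) (f : field) :
  a < b -> c < d -> continuous2 f -> (forall x y, Rabs (f x y) <= C) ->
  Rabs (RInt2 a b c d f) <= (b - a) * ((d - c) * C).
Proof.
  intros Hab Hcd Hf HC. apply abs_RInt_le_const; [lra|apply ex_RInt_RInt_y; assumption|].
  intros x _. apply abs_RInt_le_const; [lra|apply continuous2_ex_RInt_y, Hf|]. auto.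
Qed.

(** Shifting the interval trades [[a, a + s]] for [[b, b + s]], one period
    further, where [p] has the same integral. *)
Lemma RInt_periodic_shift (a b s : R) (p : R -> R) :
  (forall x, continuous p x) -> (forall x, p (x + (b - a)) = p x) ->
  RInt (fun x => p (x + s)) a b = RInt p a b.
Proof.
  intros Hc Hp.
  assert (Hex : forall u v, ex_RInt p u v).
  { intros u v. apply (ex_RInt_continuous (V := R_CompleteNormedModule)). auto. }
  assert (Hsh : forall r u v, RInt (fun x => p (x + r)) u v = RInt p (u + r) (v + r)).
  { intros r u v.
    pose proof (RInt_comp_lin (V := R_CompleteNormedModule) p 1 r u v (Hex _ _)) as K.
    rewrite !Rmult_1_l in K. rewrite <- K. apply RInt_ext. intros x _.
    unfold scal; simpl; unfold mult; simpl. now rewrite !Rmult_1_l. }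
  rewrite Hsh.
  assert (E : RInt p a (a + s) = RInt p b (b + s)).
  { replace b with (a + (b - a)) at 1 by ring.
    replace (b + s) with (a + s + (b - a)) by ring.
    rewrite <- Hsh. apply RInt_ext. intros x _. symmetry; apply Hp. }
  pose proof (RInt_Chasles (V := R_CompleteNormedModule) p a (a + s) (b + s) (Hex _ _) (Hex _ _)) as C1.
  pose proof (RInt_Chasles (V := R_CompleteNormedModule) p a b (b + s) (Hex _ _) (Hex _ _)) as C2.
  unfold plus in C1, C2; simpl in C1, C2. lra.
Qed.

Lemma RInt2_translate (a b c d s t : R) (g : field) :
  c < d -> continuous2 g -> biperiodic a b c d g ->
  RInt2 a b c d (fun x y => g (x + s) (y + t)) = RInt2 a b c d g.
Proof.
  intros Hcd Hg [Hx Hy]. unfold RInt2.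
  transitivity (RInt (fun x => RInt (fun y => g (x + s) y) c d) a b).
  - apply RInt_ext. intros x _.
    apply (RInt_periodic_shift c d t (fun y => g (x + s) y)).
    + intros y. apply continuous2_slice_y, Hg.
    + intros y. apply Hy.
  - apply (RInt_periodic_shift a b s (fun x => RInt (fun y => g x y) c d)).
    + intros x. apply continuous_RInt_y; assumption.
    + intros x. apply RInt_ext. intros y _. apply Hx.
Qed.

(** * Differentiation under the double integral *)

(** A remainder of second order passes through the integral as a plain bound,
    which is why differentiability is reduced to it below. *)
Lemma is_derive_quadratic_remainder (F : R -> R) (r l K : R) :
  (forall z, Rabs (F z - F r - (z - r) * l) <= K * (z - r) ^ 2) -> is_derive F r l.
Proof.
  intros HK. apply is_derive_Reals. intros eps Heps.
  assert (HK0 : 0 < Rabs K + 1) by (pose proof (Rabs_pos K); lra).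
  assert (Hd : 0 < eps / (Rabs K + 1)) by (apply Rdiv_lt_0_compat; lra).
  exists (mkposreal _ Hd). intros h Hh Hlt. simpl in Hlt.
  replace ((F (r + h) - F r) / h - l)
    with ((F (r + h) - F r - (r + h - r) * l) / h) by (field; exact Hh).
  unfold Rdiv. rewrite Rabs_mult, Rabs_inv.
  assert (Hh0 : 0 < Rabs h) by (apply Rabs_pos_lt, Hh).
  apply Rmult_lt_reg_r with (Rabs h); [exact Hh0|].
  rewrite Rmult_assoc, Rinv_l, Rmult_1_r by lra.
  eapply Rle_lt_trans; [apply HK|].
  replace (r + h - r) with h by ring. rewrite <- (pow2_abs h).
  pose proof (Rle_abs K).
  assert (Rabs h * (Rabs K + 1) < eps).
  { apply Rmult_lt_compat_r with (r := Rabs K + 1) in Hlt; [|lra].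
    replace (eps / (Rabs K + 1) * (Rabs K + 1)) with eps in Hlt by (field; lra).
    exact Hlt. }
  nra.
Qed.

(** The mean value inequality is used twice: for [p1], and then for
    [p x - x * p1 r], whose derivative is [p1 x - p1 r]. The constant [C] is not
    the optimal [C / 2]. *)
Lemma taylor_quadratic_remainder (p p1 p2 : R -> R) (C r z : R) :
  (forall x, is_derive p x (p1 x)) -> (forall x, is_derive p1 x (p2 x)) ->
  (forall x, Rabs (p2 x) <= C) ->
  Rabs (p z - p r - (z - r) * p1 r) <= C * (z - r) ^ 2.
Proof.
  intros H1 H2 HC.
  assert (HC0 : 0 <= C) by (eapply Rle_trans; [apply Rabs_pos | apply (HC 0)]).
  replace (p z - p r - (z - r) * p1 r) with
    ((p z - z * p1 r) - (p r - r * p1 r)) by ring.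
  rewrite <- (pow2_abs (z - r)).
  replace (C * Rabs (z - r) ^ 2) with (C * Rabs (z - r) * Rabs (z - r)) by ring.
  apply (bounded_variation (fun x => p x - x * p1 r) (fun x => p1 x - p1 r)).
  intros t Ht. split.
  - apply (is_derive_minus (V := R_NormedModule) p (fun x => x * p1 r)); [apply H1|].
    auto_derive; [exact I|ring].
  - apply Rle_trans with (C * Rabs (t - r)).
    + apply (bounded_variation p1 p2). intros y _. split; auto.
    + apply Rmult_le_compat_l; assumption.
Qed.

(** The bound on the second derivative [G2] makes the Taylor remainder of [G]
    uniform over the domain of integration. *)
Lemma is_derive_RInt2_param (a b c d C : R) (G G1 G2 : R -> field) (r : R) :
  a < b -> c < d ->
  (forall z x y, is_derive (fun z => G z x y) z (G1 z x y)) ->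
  (forall z x y, is_derive (fun z => G1 z x y) z (G2 z x y)) ->
  (forall z x y, Rabs (G2 z x y) <= C) ->
  (forall z, continuous2 (G z)) -> (forall z, continuous2 (G1 z)) ->
  is_derive (fun z => RInt2 a b c d (G z)) r (RInt2 a b c d (G1 r)).
Proof.
  intros Hab Hcd D1 D2 HC C0 C1.
  apply is_derive_quadratic_remainder with ((b - a) * (d - c) * C).
  intros z.
  replace (RInt2 a b c d (G z) - RInt2 a b c d (G r) - (z - r) * RInt2 a b c d (G1 r))
    with (RInt2 a b c d
            (fun x y => G z x y + (-1 * G r x y + - (z - r) * G1 r x y))).
  - replace ((b - a) * (d - c) * C * (z - r) ^ 2)
      with ((b - a) * ((d - c) * (C * (z - r) ^ 2))) by ring.
    apply abs_RInt2_le; auto.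
    + apply continuous2_plus; [apply C0|].
      apply continuous2_plus; apply continuous2_scal; auto.
    + intros x y.
      replace (G z x y + (-1 * G r x y + - (z - r) * G1 r x y))
        with (G z x y - G r x y - (z - r) * G1 r x y) by ring.
      apply (taylor_quadratic_remainder (fun z => G z x y) (fun z => G1 z x y)
               (fun z => G2 z x y)); auto.
  - rewrite RInt2_plus, RInt2_plus, !RInt2_scal; auto using continuous2_plus, continuous2_scal.
    ring.
Qed.

(** * Correlation functions *)

Definition correlation (a b c d : R) (g f : field) : field :=
  fun s t => RInt2 a b c d (fun x y => g (x + s) (y + t) * f x y).

Lemma continuous2_correlation_integrand (g f : field) (s t : R) :
  continuous2 g -> continuous2 f ->
  continuous2 (fun x y => g (x + s) (y + t) * f x y).
Proof.
  intros Hg Hf. apply continuous2_mult; [apply continuous2_translate, Hg | exact Hf].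
Qed.

Lemma is_derive_correlation_x (a b c d : R) (g f : field) (s t : R) :
  a < b -> c < d -> smooth_periodic a b c d g -> smooth_periodic a b c d f ->
  is_derive (fun z => correlation a b c d g f z t) s (correlation a b c d (dx g) f s t).
Proof.
  intros Hab Hcd Hg Hf.
  pose proof (smooth_periodic_dx _ _ _ _ _ Hg) as Hg1.
  pose proof (smooth_periodic_dx _ _ _ _ _ Hg1) as Hg2.
  destruct Hg as [Sg _], Hg1 as [Sg1 _], Hg2 as [Sg2 Pg2], Hf as [Sf Pf].
  destruct (biperiodic_bounded a b c d (dx (dx g))) as [Cg HCg];
    auto using smooth_continuous2.
  destruct (biperiodic_bounded a b c d f) as [Cf HCf]; auto using smooth_continuous2.
  assert (Hscal : forall p : field, smooth p -> forall z x y,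
    is_derive (fun z => p (x + z) (y + t) * f x y) z (dx p (x + z) (y + t) * f x y)).
  { intros p Hp z x y.
    apply is_derive_ext with (fun z => f x y * p (z + x) (y + t)).
    { intros w. now rewrite (Rplus_comm w x), Rmult_comm. }
    rewrite Rmult_comm. apply is_derive_scal.
    apply is_derive_shift with (p := fun z => p z (y + t)).
    rewrite (Rplus_comm z x). apply smooth_is_derive_x, Hp. }
  apply (is_derive_RInt2_param a b c d (Cg * Cf)
    (fun z x y => g (x + z) (y + t) * f x y)
    (fun z x y => dx g (x + z) (y + t) * f x y)
    (fun z x y => dx (dx g) (x + z) (y + t) * f x y)); auto.
  - intros z x y. rewrite Rabs_mult.
    apply Rmult_le_compat; auto using Rabs_pos.
  - intros z. apply continuous2_correlation_integrand; auto using smooth_continuous2.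
  - intros z. apply continuous2_correlation_integrand; auto using smooth_continuous2.
Qed.

Lemma is_derive_correlation_y (a b c d : R) (g f : field) (s t : R) :
  a < b -> c < d -> smooth_periodic a b c d g -> smooth_periodic a b c d f ->
  is_derive (fun z => correlation a b c d g f s z) t (correlation a b c d (dy g) f s t).
Proof.
  intros Hab Hcd Hg Hf.
  pose proof (smooth_periodic_dy _ _ _ _ _ Hg) as Hg1.
  pose proof (smooth_periodic_dy _ _ _ _ _ Hg1) as Hg2.
  destruct Hg as [Sg _], Hg1 as [Sg1 _], Hg2 as [Sg2 Pg2], Hf as [Sf Pf].
  destruct (biperiodic_bounded a b c d (dy (dy g))) as [Cg HCg];
    auto using smooth_continuous2.
  destruct (biperiodic_bounded a b c d f) as [Cf HCf]; auto using smooth_continuous2.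
  assert (Hscal : forall p : field, smooth p -> forall z x y,
    is_derive (fun z => p (x + s) (y + z) * f x y) z (dy p (x + s) (y + z) * f x y)).
  { intros p Hp z x y.
    apply is_derive_ext with (fun z => f x y * p (x + s) (z + y)).
    { intros w. now rewrite (Rplus_comm w y), Rmult_comm. }
    rewrite Rmult_comm. apply is_derive_scal.
    apply is_derive_shift with (p := fun z => p (x + s) z).
    rewrite (Rplus_comm z y). apply smooth_is_derive_y, Hp. }
  apply (is_derive_RInt2_param a b c d (Cg * Cf)
    (fun z x y => g (x + s) (y + z) * f x y)
    (fun z x y => dy g (x + s) (y + z) * f x y)
    (fun z x y => dy (dy g) (x + s) (y + z) * f x y)); auto.
  - intros z x y. rewrite Rabs_mult.
    apply Rmult_le_compat; auto using Rabs_pos.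
  - intros z. apply continuous2_correlation_integrand; auto using smooth_continuous2.
  - intros z. apply continuous2_correlation_integrand; auto using smooth_continuous2.
Qed.

Lemma biperiodic_correlation (a b c d : R) (g f : field) :
  biperiodic a b c d g -> biperiodic a b c d (correlation a b c d g f).
Proof.
  intros [Hx Hy]. split; intros s t; apply RInt2_ext; intros x y; f_equal.
  - rewrite <- Rplus_assoc. apply Hx.
  - rewrite <- Rplus_assoc. apply Hy.
Qed.

(** Applied to the partial derivatives of [g], this gives a Lipschitz bound and
    hence the joint continuity of [correlation g f]. *)
Lemma correlation_bounded (a b c d : R) (g f : field) :
  a < b -> c < d -> smooth_periodic a b c d g -> smooth_periodic a b c d f ->
  exists C, forall s t, Rabs (correlation a b c d g f s t) <= C.
Proof.
  intros Hab Hcd [Sg Pg] [Sf Pf].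
  destruct (biperiodic_bounded a b c d g) as [Cg HCg]; auto using smooth_continuous2.
  destruct (biperiodic_bounded a b c d f) as [Cf HCf]; auto using smooth_continuous2.
  exists ((b - a) * ((d - c) * (Cg * Cf))). intros s t.
  apply abs_RInt2_le; auto.
  - apply continuous2_correlation_integrand; auto using smooth_continuous2.
  - intros x y. rewrite Rabs_mult. apply Rmult_le_compat; auto using Rabs_pos.
Qed.

Lemma continuous2_of_bounded_partials (F Fx Fy : field) (Cx Cy : R) :
  (forall x y, is_derive (fun z => F z y) x (Fx x y)) ->
  (forall x y, is_derive (fun z => F x z) y (Fy x y)) ->
  (forall x y, Rabs (Fx x y) <= Cx) -> (forall x y, Rabs (Fy x y) <= Cy) ->
  continuous2 F.
Proof.
  intros Dx Dy Bx By x y eps.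
  assert (Px : 0 <= Cx) by (eapply Rle_trans; [apply Rabs_pos | apply (Bx 0 0)]).
  assert (Py : 0 <= Cy) by (eapply Rle_trans; [apply Rabs_pos | apply (By 0 0)]).
  assert (Hd : 0 < eps / (Cx + Cy + 1)) by (apply Rdiv_lt_0_compat; [apply cond_pos | lra]).
  exists (mkposreal _ Hd). simpl. intros u v Hu Hv.
  replace (F u v - F x y) with ((F u v - F x v) + (F x v - F x y)) by ring.
  eapply Rle_lt_trans; [apply Rabs_triang|].
  assert (H1 : Rabs (F u v - F x v) <= Cx * Rabs (u - x)).
  { apply (bounded_variation (fun z => F z v) (fun z => Fx z v)). auto. }
  assert (H2 : Rabs (F x v - F x y) <= Cy * Rabs (v - y)).
  { apply (bounded_variation (fun z => F x z) (fun z => Fy x z)). auto. }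
  set (de := eps / (Cx + Cy + 1)) in *.
  assert (E : de * (Cx + Cy + 1) = eps) by (unfold de; field; lra).
  nra.
Qed.

Lemma continuous2_correlation (a b c d : R) (g f : field) :
  a < b -> c < d -> smooth_periodic a b c d g -> smooth_periodic a b c d f ->
  continuous2 (correlation a b c d g f).
Proof.
  intros Hab Hcd Hg Hf.
  destruct (correlation_bounded a b c d (dx g) f) as [Cx Bx]; auto using smooth_periodic_dx.
  destruct (correlation_bounded a b c d (dy g) f) as [Cy By]; auto using smooth_periodic_dy.
  apply (continuous2_of_bounded_partials _ (correlation a b c d (dx g) f)
           (correlation a b c d (dy g) f) Cx Cy); auto.
  - intros x y. apply is_derive_correlation_x; auto.
  - intros x y. apply is_derive_correlation_y; auto.
Qed.

(** Substituting [(x + s, y + t)] for [(x, y)], which leaves the integral over a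
    period unchanged, exchanges the two factors. *)
Lemma autocorrelation_even (a b c d : R) (f : field) (s t : R) :
  c < d -> continuous2 f -> biperiodic a b c d f ->
  correlation a b c d f f (- s) (- t) = correlation a b c d f f s t.
Proof.
  intros Hcd Hf Pf. unfold correlation.
  rewrite <- (RInt2_translate a b c d s t (fun x y => f (x + - s) (y + - t) * f x y)).
  - apply RInt2_ext. intros x y.
    replace (x + s + - s) with x by ring. replace (y + t + - t) with y by ring.
    ring.
  - exact Hcd.
  - apply continuous2_correlation_integrand; exact Hf.
  - apply biperiodic_mult; [apply biperiodic_translate|]; exact Pf.
Qed.
Lemma autocorrelation_dx_odd (a b c d : R) (f : field) (s t : R) :
  a < b -> c < d -> smooth_periodic a b c d f ->
  correlation a b c d (dx f) f (- s) (- t) = - correlation a b c d (dx f) f s t.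
Proof.
  intros Hab Hcd Hf.
  assert (Heven : forall z, correlation a b c d f f (- z) (- t) = correlation a b c d f f z t).
  { intros z. destruct Hf as [Sf Pf]. apply autocorrelation_even; auto using smooth_continuous2. }
  pose proof (is_derive_reflect (fun z => correlation a b c d f f z (- t)) _ s
    (is_derive_correlation_x a b c d f f (- s) (- t) Hab Hcd Hf Hf)) as D1.
  apply (is_derive_ext _ _ _ _ Heven) in D1.
  apply is_derive_unique in D1.
  transitivity (- Derive (fun z => correlation a b c d f f z t) s).
  - rewrite D1. ring.
  - f_equal. apply is_derive_unique, is_derive_correlation_x; assumption.
Qed.

Lemma autocorrelation_dy_odd (a b c d : R) (f : field) (s t : R) :
  a < b -> c < d -> smooth_periodic a b c d f ->
  correlation a b c d (dy f) f (- s) (- t) = - correlation a b c d (dy f) f s t.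
Proof.
  intros Hab Hcd Hf.
  assert (Heven : forall z, correlation a b c d f f (- s) (- z) = correlation a b c d f f s z).
  { intros z. destruct Hf as [Sf Pf]. apply autocorrelation_even; auto using smooth_continuous2. }
  pose proof (is_derive_reflect (fun z => correlation a b c d f f (- s) z) _ t
    (is_derive_correlation_y a b c d f f (- s) (- t) Hab Hcd Hf Hf)) as D1.
  apply (is_derive_ext _ _ _ _ Heven) in D1.
  apply is_derive_unique in D1.
  transitivity (- Derive (correlation a b c d f f s) t).
  - rewrite D1. ring.
  - f_equal. apply is_derive_unique, is_derive_correlation_y; assumption.
Qed.

Lemma correlation_combination (a b c d p q r : R) (g1 g2 g3 g f : field) (s t : R) :
  c < d -> continuous2 g1 -> continuous2 g2 -> continuous2 g3 -> continuous2 f ->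
  (forall x y, g x y = p * g1 x y + (q * g2 x y + r * g3 x y)) ->
  correlation a b c d g f s t =
  p * correlation a b c d g1 f s t +
  (q * correlation a b c d g2 f s t + r * correlation a b c d g3 f s t).
Proof.
  intros Hcd C1 C2 C3 Cf E. unfold correlation.
  rewrite (RInt2_ext a b c d _
    (fun x y => p * (g1 (x + s) (y + t) * f x y) +
      (q * (g2 (x + s) (y + t) * f x y) + r * (g3 (x + s) (y + t) * f x y)))).
  - rewrite !RInt2_plus, !RInt2_scal;
      auto using continuous2_plus, continuous2_scal, continuous2_correlation_integrand.
  - intros x y. rewrite E. ring.
Qed.

(** * Skewness of the operator S *)

(** The even part of the correlation of [k] with [f] solves the homogeneous
    Helmholtz equation, because the gradient of the autocorrelation of [f] is
    odd; so it vanishes, in particular at the origin. *)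
Lemma S_graph_orthogonal (a b c d alpha beta mu theta : R) (f k : field) :
  a < b -> c < d -> 0 < mu -> 0 < theta ->
  S_graph a b c d alpha beta mu theta f k ->
  RInt2 a b c d (fun x y => k x y * f x y) = 0.
Proof.
  intros Hab Hcd Hmu Htheta [Hf [Hk Heq]].
  assert (Heq' : forall x y, k x y - mu * dx (dx k) x y - theta * dy (dy k) x y =
    - (alpha * dx f x y + beta * dy f x y)) by exact Heq.
  clear Heq.
  pose (F := fun g => correlation a b c d g f).
  pose proof (smooth_periodic_dx _ _ _ _ _ Hk) as Hkx.
  pose proof (smooth_periodic_dx _ _ _ _ _ Hkx) as Hkxx.
  pose proof (smooth_periodic_dy _ _ _ _ _ Hk) as Hky.
  pose proof (smooth_periodic_dy _ _ _ _ _ Hky) as Hkyy.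
  pose proof (smooth_periodic_dx _ _ _ _ _ Hf) as Hfx.
  pose proof (smooth_periodic_dy _ _ _ _ _ Hf) as Hfy.
  assert (cont : forall g, smooth_periodic a b c d g -> continuous2 g)
    by (intros g [Sg _]; apply smooth_continuous2, Sg).
  (* The equation between [k] and [f], correlated with [f]. *)
  assert (HLF : forall s t,
    F k s t - mu * F (dx (dx k)) s t - theta * F (dy (dy k)) s t =
    - (alpha * F (dx f) s t + beta * F (dy f) s t)).
  { intros s t.
    pose (g := fun x y => 1 * k x y + (- mu * dx (dx k) x y + - theta * dy (dy k) x y)).
    assert (E1 : F g s t = 1 * F k s t +
        (- mu * F (dx (dx k)) s t + - theta * F (dy (dy k)) s t))
      by exact (correlation_combination a b c d 1 (- mu) (- theta) _ _ _ g f s t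
                  Hcd (cont _ Hk) (cont _ Hkxx) (cont _ Hkyy) (cont _ Hf)
                  (fun x y => eq_refl)).
    assert (E2 : F g s t = - alpha * F (dx f) s t +
        (- beta * F (dy f) s t + 0 * F (dy f) s t)).
    { apply (correlation_combination a b c d (- alpha) (- beta) 0 _ _ _ g f s t
               Hcd (cont _ Hfx) (cont _ Hfy) (cont _ Hfy) (cont _ Hf)).
      intros x y. pose proof (Heq' x y). unfold g. lra. }
    lra. }
  (* The even part of [F k], up to the factor 2, evaluated at the origin. Each
     derivative of a reflected term changes its sign. *)
  assert (H0 : F k 0 0 + F k (- 0) (- 0) = 0).
  { apply (helmholtz_unique a b c d mu theta
      (fun s t => F k s t + F k (- s) (- t))
      (fun s t => F (dx k) s t + - F (dx k) (- s) (- t))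
      (fun s t => F (dy k) s t + - F (dy k) (- s) (- t))
      (fun s t => F (dx (dx k)) s t + - - F (dx (dx k)) (- s) (- t))
      (fun s t => F (dy (dy k)) s t + - - F (dy (dy k)) (- s) (- t)));
      try assumption.
    - apply continuous2_plus; [exact (continuous2_correlation a b c d k f Hab Hcd Hk Hf)|].
      intros s t eps.
      destruct (continuous2_correlation a b c d k f Hab Hcd Hk Hf (- s) (- t) eps) as [de Hde].
      exists de. intros u v Hu Hv. apply Hde.
      + replace (- u - - s) with (- (u - s)) by ring. now rewrite Rabs_Ropp.
      + replace (- v - - t) with (- (v - t)) by ring. now rewrite Rabs_Ropp.
    - destruct (biperiodic_correlation a b c d k f (proj2 Hk)) as [Px Py].
      unfold F. split; intros s t.
      + rewrite Px, <- (Px (- (s + (b - a)))). do 2 f_equal. ring.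
      + rewrite Py, <- (Py _ (- (t + (d - c)))). do 2 f_equal. ring.
    - intros s t. apply (is_derive_plus (V := R_NormedModule)).
      + exact (is_derive_correlation_x a b c d _ f _ _ Hab Hcd Hk Hf).
      + apply is_derive_reflect with (p := fun z => F k z (- t)).
        exact (is_derive_correlation_x a b c d _ f _ _ Hab Hcd Hk Hf).
    - intros s t. apply (is_derive_plus (V := R_NormedModule)).
      + exact (is_derive_correlation_x a b c d _ f _ _ Hab Hcd Hkx Hf).
      + apply (is_derive_opp (V := R_NormedModule) (fun z => F (dx k) (- z) (- t))).
        apply is_derive_reflect with (p := fun z => F (dx k) z (- t)).
        exact (is_derive_correlation_x a b c d _ f _ _ Hab Hcd Hkx Hf).
    - intros s t. apply (is_derive_plus (V := R_NormedModule)).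
      + exact (is_derive_correlation_y a b c d _ f _ _ Hab Hcd Hk Hf).
      + apply is_derive_reflect with (p := fun z => F k (- s) z).
        exact (is_derive_correlation_y a b c d _ f _ _ Hab Hcd Hk Hf).
    - intros s t. apply (is_derive_plus (V := R_NormedModule)).
      + exact (is_derive_correlation_y a b c d _ f _ _ Hab Hcd Hky Hf).
      + apply (is_derive_opp (V := R_NormedModule) (fun z => F (dy k) (- s) (- z))).
        apply is_derive_reflect with (p := fun z => F (dy k) (- s) z).
        exact (is_derive_correlation_y a b c d _ f _ _ Hab Hcd Hky Hf).
    - intros s t.
      pose proof (HLF s t). pose proof (HLF (- s) (- t)).
      assert (F (dx f) (- s) (- t) = - F (dx f) s t) as O1 by exact (autocorrelation_dx_odd a b c d f s t Hab Hcd Hf).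
      assert (F (dy f) (- s) (- t) = - F (dy f) s t) as O2 by exact (autocorrelation_dy_odd a b c d f s t Hab Hcd Hf).
      rewrite O1, O2 in *. lra. }
  rewrite Ropp_0 in H0.
  rewrite (RInt2_ext a b c d _ (fun x y => k (x + 0) (y + 0) * f x y)).
  - change (F k 0 0 = 0). lra.
  - intros x y. now rewrite !Rplus_0_r.
Qed.

(** * Products along a symplectic Runge-Kutta step *)

Lemma sum_n_m_Rplus (f g : nat -> R) (n m : nat) :
  sum_n_m (fun i => f i + g i) n m = sum_n_m f n m + sum_n_m g n m.
Proof. apply (sum_n_m_plus (G := R_AbelianMonoid)). Qed.

Lemma sum_n_m_Rscal (l : R) (f : nat -> R) (n m : nat) :
  sum_n_m (fun i => l * f i) n m = l * sum_n_m f n m.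
Proof. apply (sum_n_m_mult_l (K := R_Ring)). Qed.

Lemma sum_n_m_Rext (f g : nat -> R) (n m : nat) :
  (forall i, (n <= i <= m)%nat -> f i = g i) -> sum_n_m f n m = sum_n_m g n m.
Proof. apply (sum_n_m_ext_loc (G := R_AbelianMonoid)). Qed.

Lemma sum_1_s_switch (F : nat -> nat -> R) (s : nat) :
  sum_n_m (fun i => sum_n_m (fun j => F i j) 1 s) 1 s =
  sum_n_m (fun j => sum_n_m (fun i => F i j) 1 s) 1 s.
Proof.
  destruct s as [|s]; [now rewrite !sum_n_m_zero by lia|].
  assert (E : forall F : nat -> nat -> R,
    sum_n_m (fun i => sum_n_m (fun j => F i j) 1 (S s)) 1 (S s) =
    sum_n (fun i => sum_n (fun j => F (S i) (S j)) s) s).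
  { intros F'. rewrite <- (sum_n_m_S _ 0 s). apply sum_n_m_ext. intros i.
    now rewrite <- (sum_n_m_S _ 0 s). }
  rewrite (E F), (E (fun j i => F i j)). apply sum_n_switch.
Qed.

(** A discrete Leibniz rule. Replacing [u] and [q] by the stage values costs
    [tau^2] double sums with weights [w i * A i j] and, after exchange of the
    indices, [w j * A j i]; the condition turns their total into the product of
    the two increments. *)
Lemma symplectic_product (s : nat) (A : nat -> nat -> R) (w : nat -> R) (tau u q : R)
    (k l : nat -> R) :
  (forall i j : nat, (1 <= i <= s)%nat -> (1 <= j <= s)%nat ->
     w i * A i j + w j * A j i = w i * w j) ->
  (u + tau * sum_n_m (fun i => w i * k i) 1 s) *
  (q + tau * sum_n_m (fun i => w i * l i) 1 s) =
  u * q + tau * sum_n_m (fun i => w i *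
    ((u + tau * sum_n_m (fun j => A i j * k j) 1 s) * l i +
     k i * (q + tau * sum_n_m (fun j => A i j * l j) 1 s))) 1 s.
Proof.
  intros Hsym.
  set (K := sum_n_m (fun i => w i * k i) 1 s).
  set (L := sum_n_m (fun i => w i * l i) 1 s).
  assert (Hstages : sum_n_m (fun i => w i *
    ((u + tau * sum_n_m (fun j => A i j * k j) 1 s) * l i +
     k i * (q + tau * sum_n_m (fun j => A i j * l j) 1 s))) 1 s =
    u * L + q * K + tau *
     (sum_n_m (fun i => sum_n_m (fun j => w i * A i j * (k j * l i)) 1 s) 1 s +
      sum_n_m (fun i => sum_n_m (fun j => w i * A i j * (k i * l j)) 1 s) 1 s)).
  { unfold K, L. rewrite <- sum_n_m_Rplus, <- !sum_n_m_Rscal, <- !sum_n_m_Rplus.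
    apply sum_n_m_Rext. intros i _.
    rewrite (sum_n_m_Rext (fun j => w i * A i j * (k j * l i))
      (fun j => (w i * l i) * (A i j * k j))) by (intros j _; ring).
    rewrite (sum_n_m_Rext (fun j => w i * A i j * (k i * l j))
      (fun j => (w i * k i) * (A i j * l j))) by (intros j _; ring).
    rewrite !sum_n_m_Rscal. ring. }
  assert (Hcross :
     sum_n_m (fun i => sum_n_m (fun j => w i * A i j * (k j * l i)) 1 s) 1 s +
     sum_n_m (fun i => sum_n_m (fun j => w i * A i j * (k i * l j)) 1 s) 1 s = K * L).
  { rewrite sum_1_s_switch.
    rewrite <- sum_n_m_Rplus.
    transitivity (sum_n_m (fun i => L * (w i * k i)) 1 s).
    - apply sum_n_m_Rext. intros i Hi.
      rewrite <- sum_n_m_Rplus, Rmult_comm. unfold L. rewrite <- sum_n_m_Rscal.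
      apply sum_n_m_Rext. intros j Hj.
      pose proof (Hsym i j Hi Hj).
      transitivity ((w i * A i j + w j * A j i) * (k i * l j)); [ring|].
      rewrite H. ring.
    - rewrite sum_n_m_Rscal. unfold K. ring. }
  rewrite Hstages, Hcross. ring.
Qed.

(** * Conservation of the energy *)

Lemma continuous2_sum (s : nat) (G : nat -> field) :
  (forall i, (1 <= i <= s)%nat -> continuous2 (G i)) ->
  continuous2 (fun x y => sum_n_m (fun i => G i x y) 1 s).
Proof.
  induction s as [|s IH]; intros HG x y.
  - apply continuity_2d_pt_ext with (fun _ _ => 0).
    + intros u v. now rewrite sum_n_m_zero by lia.
    + apply continuity_2d_pt_const.
  - apply continuity_2d_pt_ext with
      (fun x y => sum_n_m (fun i => G i x y) 1 s + G (S s) x y).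
    + intros u v. now rewrite sum_n_Sm by lia.
    + apply continuity_2d_pt_plus; [apply IH; intros i Hi|]; apply HG; lia.
Qed.

Lemma RInt2_sum (a b c d : R) (s : nat) (G : nat -> field) :
  c < d -> (forall i, (1 <= i <= s)%nat -> continuous2 (G i)) ->
  RInt2 a b c d (fun x y => sum_n_m (fun i => G i x y) 1 s) =
  sum_n_m (fun i => RInt2 a b c d (G i)) 1 s.
Proof.
  intros Hcd. induction s as [|s IH]; intros HG.
  - rewrite sum_n_m_zero by lia.
    rewrite (RInt2_ext a b c d _ (fun _ _ => 0 * 0)).
    + rewrite RInt2_scal; [apply Rmult_0_l | exact Hcd |].
      intros x y. apply continuity_2d_pt_const.
    + intros x y. rewrite sum_n_m_zero by lia. symmetry; apply Rmult_0_l.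
  - rewrite sum_n_Sm by lia.
    rewrite (RInt2_ext a b c d _ (fun x y => sum_n_m (fun i => G i x y) 1 s + G (S s) x y)).
    + assert (HG' : forall i, (1 <= i <= s)%nat -> continuous2 (G i))
        by (intros i Hi; apply HG; lia).
      rewrite RInt2_plus, (IH HG').
      * reflexivity.
      * exact Hcd.
      * apply continuous2_sum, HG'.
      * apply HG. lia.
    + intros x y. now rewrite sum_n_Sm by lia.
Qed.

Theorem theorem2p5
  (a b c d : R) (Hab : a < b) (Hcd : c < d)
  (alpha beta mu theta : R) (Hmu : 0 < mu) (Htheta : 0 < theta)
  (s : nat) (Hs : (1 <= s)%nat)
  (A : nat -> nat -> R) (w nodes : nat -> R)
  (Hnodes : forall i : nat, (1 <= i <= s)%nat ->
     nodes i = sum_n_m (fun j => A i j) 1 s)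
  (Hdistinct : forall i j : nat, (1 <= i <= s)%nat -> (1 <= j <= s)%nat ->
     nodes i = nodes j -> i = j)
  (Hsympl : forall i j : nat, (1 <= i <= s)%nat -> (1 <= j <= s)%nat ->
     w i * A i j + w j * A j i = w i * w j)
  (M : nat) (HM : (0 < M)%nat) (tau : R) (Htau : 0 < tau)
  (u q : nat -> field)
  (Hu : forall n : nat, smooth_periodic a b c d (u n))
  (Hq : forall n : nat, smooth_periodic a b c d (q n))
  (Hscheme : forall n : nat,
     pc_step (S_graph a b c d alpha beta mu theta) s A w tau M
       (u n) (q n) (u (S n)) (q (S n))) :
  forall n : nat, energy a b c d (u (S n)) (q (S n)) = energy a b c d (u n) (q n).
Proof.
  intros n.
  destruct (Hscheme n) as (kp & ui & qi & ki & li & _ & Hcorr & Hu1 & Hq1).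
  set (us := rk_stage s A tau (u n) (kp M)) in *.
  (* The argument of S in the correction stage. *)
  pose (fi := fun i x y => ui i x y + / 6 * qi i x y + / 3 * (us i x y * ui i x y)).
  pose (e := fun x y => / 2 * (u n x y) ^ 2 + / 6 * (u n x y * q n x y)).
  assert (Hun : continuous2 (u n)) by apply smooth_continuous2, (Hu n).
  assert (Hqn : continuous2 (q n)) by apply smooth_continuous2, (Hq n).
  assert (He : continuous2 e).
  { apply continuous2_plus; apply continuous2_scal; [|apply continuous2_mult; assumption].
    intros x y. apply continuity_2d_pt_ext with (fun x y => u n x y * u n x y).
    - intros; ring.
    - apply continuous2_mult; assumption. }
  assert (HG : forall i, (1 <= i <= s)%nat ->
    continuous2 (fun x y => w i * (ki i x y * fi i x y))).
  { intros i Hi. destruct (Hcorr i Hi) as [[[Sf _] [[Sk _] _]] _].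
    apply continuous2_scal, continuous2_mult; apply smooth_continuous2; assumption. }
  change (RInt2 a b c d
    (fun x y => / 2 * (u (S n) x y) ^ 2 + / 6 * (u (S n) x y * q (S n) x y)) =
    RInt2 a b c d e).
  rewrite (RInt2_ext a b c d _
    (fun x y => e x y + tau * sum_n_m (fun i => w i * (ki i x y * fi i x y)) 1 s)).
  - rewrite RInt2_plus, RInt2_scal, RInt2_sum;
      auto using continuous2_scal, continuous2_sum.
    rewrite (sum_n_m_Rext _ (fun _ => 0)).
    + rewrite (sum_n_m_const_zero (G := R_AbelianMonoid)).
      unfold zero; simpl. ring.
    + intros i Hi. destruct (Hcorr i Hi) as [HS _].
      rewrite RInt2_scal; [|exact Hcd|].
      * rewrite (S_graph_orthogonal a b c d alpha beta mu theta); auto.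
        apply Rmult_0_r.
      * destruct HS as [[Sf _] [[Sk _] _]].
        apply continuous2_mult; apply smooth_continuous2; assumption.
  - intros x y. rewrite Hu1, Hq1. unfold rk_update.
    set (k := fun i => ki i x y). set (l := fun i => li i x y).
    pose proof (symplectic_product s A w tau (u n x y) (u n x y) k k Hsympl) as Puu.
    pose proof (symplectic_product s A w tau (u n x y) (q n x y) k l Hsympl) as Puq.
    replace ((u n x y + tau * sum_n_m (fun i => w i * ki i x y) 1 s) ^ 2)
      with ((u n x y + tau * sum_n_m (fun i => w i * k i) 1 s) *
            (u n x y + tau * sum_n_m (fun i => w i * k i) 1 s)) by (unfold k; ring).
    unfold k, l in *.
    rewrite Puu, Puq. unfold e.
    set (X := sum_n_m _ 1 s) at 1. set (Y := sum_n_m _ 1 s) at 1.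
    (* Here [li = 2 us ki] makes the derivative of the energy density equal to
       [ki * fi], stage by stage. *)
    assert (E : sum_n_m (fun i => w i * (ki i x y * fi i x y)) 1 s = / 2 * X + / 6 * Y).
    { unfold X, Y. rewrite <- !sum_n_m_Rscal, <- sum_n_m_Rplus.
      apply sum_n_m_Rext. intros i Hi.
      destruct (Hcorr i Hi) as (_ & Eu & Eq & El).
      unfold rk_stage in Eu, Eq. rewrite <- Eu, <- Eq, El. unfold fi. field. }
    rewrite E. field.
Qed.
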